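(* Let $\mathcal T$ be a monoid, let $(\mathcal M,*,\iota)$ be a $\mathcal T$-bimagma, and suppose that $\mathcal M$ normalizes a submonoid $G$ of $\mathcal T$. (i) Suppose $\mathcal M$ is weakly admissible, i.e. $\mathcal T\subseteq \mathcal M$. If $f:\mathcal M\to\mathcal N$ is a surjection of magmas, where $\mathcal N$ is viewed as a bimagma over $f(\mathcal T)$ via $f$, then there is a $\subseteq$-morphism $\bar f:\mathcal M/G\to\mathcal N/f(G)$ given by $\bar f(bG)=f(b)f(G)$ for $b\in\mathcal M$, where the element $f(b)f(G)$ of $\mathcal N/f(G)$ is identified with the set $\{\,b'G : b'\in \mathcal M,\ f(b)f(G)=f(b')f(G)\,\}$. (ii) If $\mathcal M$ normalizes submonoids $G\subseteq G_1$ of $\mathcal T$, then $$\mathcal M/G_1\cong(\mathcal M/G)/(G_1/G).$$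
   Context: A magma $(\mathcal M,*,\iota)$ is a set with a binary operation $*$ (not necessarily associative) and a neutral element $\iota$, i.e. $\iota*b=b*\iota=b$ for all $b$. A monoid is a magma with associative operation (not necessarily commutative). Let $\mathcal T$ be a monoid, written multiplicatively with unit $1$. A $\mathcal T$-biset is a set $\mathcal A$ with a left action and a right action of $\mathcal T$ (so $1b=b=b1$, $(a_1a_2)b=a_1(a_2b)$, $b(a_1a_2)=(ba_1)a_2$) such that $(a_1b)a_2=a_1(ba_2)$ for all $a_i\in\mathcal T$, $b\in\mathcal A$. A $\mathcal T$-bimagma is a magma $(\mathcal A,*,\iota)$ which is also a $\mathcal T$-biset with $a\iota=\iota=\iota a$ and $a(b_1*b_2)=(ab_1)*(ab_2)$ for all $a\in\mathcal T$, $b_i\in\mathcal A$. It is weakly admissible if $\mathcal T\subseteq\mathcal A$. $\mathcal M$ normalizes a submonoid $G$ of $\mathcal T$ if $bG=Gb$ for all $b\in\mathcal M$, where $bG=\{bg:g\in G\}$ and $Gb=\{gb:g\in G\}$. The quotient hypermagma $\mathcal M/G$ is the set $\{bG:b\in\mathcal M\}$ with the hyperoperation $$b_1G\boxdot b_2G=\{cG: c\in b_1G*b_2G\},$$ where $b_1G*b_2G=\{x_1*x_2:x_i\in b_iG\}$. For submonoids $G\subseteq G_1$ of $\mathcal T$ normalized by $\mathcal M$, $G_1/G=\{gG:g\in G_1\}$ acts on $\mathcal M/G$ by $(bG)(gG)=(bg)G$. The quotient $(\mathcal M/G)/(G_1/G)$ is the set of cosets $(bG)(G_1/G)=\{(bg)G:g\in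 G_1\}$, $b\in\mathcal M$, with the analogous hyperoperation: the hyperproduct of the cosets $X$ and $Y$ is the set of all cosets $z(G_1/G)$ with $z\in x\boxdot y$ for some $x\in X$, $y\in Y$, where $\boxdot$ is the hyperoperation of $\mathcal M/G$. A homomorphism of magmas is a map $f$ with $f(b_1*b_2)=f(b_1)*f(b_2)$; a surjection of magmas is an onto homomorphism. When $f:\mathcal M\to\mathcal N$ is a surjection with $\mathcal M$ a weakly admissible $\mathcal T$-bimagma, $\mathcal N$ is viewed as a bimagma over $f(\mathcal T)$ in the obvious way: $f(a)f(b)=f(ab)$ and $f(b)f(a)=f(ba)$ for $a\in\mathcal T$, $b\in\mathcal M$, with monoid structure $f(a_1)f(a_2)=f(a_1a_2)$ on $f(\mathcal T)$ (these operations are understood to be well defined). Then $f(b)f(G)=\{f(b)f(g):g\in G\}$, and $\mathcal N/f(G)=\{f(b)f(G):b\in\mathcal M\}$ has the hyperoperation defined in the same way as for $\mathcal M/G$. A $\subseteq$-morphism between sets with hyperoperations (both written $*$) is a map $f$ with $f(a_1*a_2)\subseteq f(a_1)*f(a_2)$ for all $a_1,a_2$, where $f(S)=\{f(s):s\in S\}$ for a set $S$. An isomorphism ($\cong$) is a bijective map with $f(a_1*a_2)=f(a_1)*f(a_2)$ for all $a_1,a_2$. *)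

(* Defs.v *)
From HB Require Import structures.
From mathcomp Require Import all_boot.
From mathcomp Require Import all_classical.

Set Implicit Arguments.
Unset Strict Implicit.
Unset Printing Implicit Defensive.

Import Algebra.

Local Open Scope classical_set_scope.
Local Open Scope group_scope.

HB.mixin Record isBiset (T : monoidType) A := {
  lact : T -> A -> A;
  ract : A -> T -> A;
  lact1 : forall b, lact 1 b = b;
  ract1 : forall b, ract b 1 = b;
  lactM : forall a1 a2 b, lact (a1 * a2) b = lact a1 (lact a2 b);
  ractM : forall b a1 a2, ract b (a1 * a2) = ract (ract b a1) a2;
  lractA : forall a1 b a2, ract (lact a1 b) a2 = lact a1 (ract b a2)
}.

#[short(type="bisetType")]
HB.structure Definition Biset (T : monoidType) := {A of isBiset T A}.

(* Only the left action is required to distribute over the magma operation. *)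
HB.mixin Record Biset_isBimagma (T : monoidType) A
    of UMagma A & Biset T A := {
  lact_one : forall a : T, lact a (1 : A) = 1;
  ract_one : forall a : T, ract (1 : A) a = 1;
  lact_mul : forall (a : T) (b1 b2 : A), lact a (b1 * b2) = lact a b1 * lact a b2
}.

#[short(type="bimagmaType")]
HB.structure Definition Bimagma (T : monoidType) :=
  {A of UMagma A & Biset T A & Biset_isBimagma T A}.

(* [inc] exhibits T as a subset of A. Since T is a biset over itself by
   multiplication, the inclusion is one of bisets; this is what makes the
   juxtaposition ab unambiguous for a, b in T. *)
Record weakly_admissible (T : monoidType) (A : bimagmaType T) (inc : T -> A) :
    Prop := WeaklyAdmissible {
  inc_inj : injective inc;
  inc_lact : forall a1 a2, inc (a1 * a2) = lact a1 (inc a2);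
  inc_ract : forall a1 a2, inc (a1 * a2) = ract (inc a1) a2
}.

Definition lcoset (T : monoidType) (M : bisetType T) (G : set T) (b : M) :
  set M := [set ract b g | g in G].

Definition rcoset (T : monoidType) (M : bisetType T) (G : set T) (b : M) :
  set M := [set lact g b | g in G].

Definition normalizes (T : monoidType) (M : bisetType T) (G : set T) : Prop :=
  forall b : M, lcoset G b = rcoset G b.

Section HyperQuotient.
Variables (A : Type) (op : A -> A -> set A) (cls : A -> set A).

(* The set of all classes [cls b], with the hyperproduct of X and Y the set of
   the classes of the elements of op x y, for x in X and y in Y. Both M/G and
   (M/G)/(G1/G) are instances. *)
Definition hquot : Type := range cls.

Definition hclass (b : A) : hquot := exist _ (cls b) (mem_set (imageT cls b)).

Definition hquot_op (X Y : hquot) : set hquot :=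
  [set hclass z | z in
    [set z | exists x y, [/\ val X x, val Y y & op x y z]]].

End HyperQuotient.

Section Quotient.
Variables (T : monoidType) (M : bimagmaType T) (G : set T).

Definition mquot : Type := hquot (@lcoset T M G).

Definition mcoset (b : M) : mquot := hclass (@lcoset T M G) b.

Definition mquot_op : mquot -> mquot -> set mquot :=
  @hquot_op M (fun x y => [set x * y]) (@lcoset T M G).

End Quotient.
Arguments mquot {T} M G.
Arguments mcoset {T M} G b.
Arguments mquot_op {T M G} X Y.

Section DoubleQuotient.
Variables (T : monoidType) (M : bimagmaType T) (G G1 : set T).

Definition gcoset (g : T) : set T := [set g * h | h in G].

Definition gquot : set (set T) := [set gcoset g | g in G1].

(* The action (bG)(gG) = (bg)G of G1/G on M/G, as a relation; it is
   single-valued by [qactE] below. *)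
Definition qact (X : mquot M G) (U : set T) : set (mquot M G) :=
  [set W | exists b g, [/\ X = mcoset G b, U = gcoset g &
                          W = mcoset G (ract b g)]].

Definition dcoset (X : mquot M G) : set (mquot M G) :=
  \bigcup_(U in gquot) qact X U.

Definition dquot : Type := hquot dcoset.

Definition dquot_op : dquot -> dquot -> set dquot :=
  @hquot_op (mquot M G) mquot_op dcoset.

Lemma qactE (b : M) (g : T) : monoid_closed [in G] -> normalizes M G ->
  qact (mcoset G b) (gcoset g) = [set mcoset G (ract b g)].
Proof.
move=> [/set_mem G1in Gmul] nG; rewrite eqEsubset; split; last first.
  by move=> _ ->; exists b, g.
move=> _ [b' [g' [eb eg ->]]]; apply: val_inj => /=.
have {}eb : lcoset G b = lcoset G b' by exact: (congr1 val eb).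
have ggE (c : M) : lcoset G (ract c g) = lcoset G (ract c g').
  have aux (k : T) : lcoset G (ract c k) = [set ract c u | u in gcoset k].
    rewrite eqEsubset; split=> [_ [h Gh <-]|_ [_ [h Gh <-] <-]].
      by exists (k * h); [exists h | rewrite ractM].
    by exists h => //; rewrite ractM.
  by rewrite !aux eg.
have sub (c d : M) : lcoset G c = lcoset G d ->
    lcoset G (ract c g) = lcoset G (ract d g).
  have aux (k : M) : lcoset G (ract k g) = [set ract x g | x in lcoset G k].
    rewrite nG (nG k) eqEsubset; split=> [_ [h Gh <-]|_ [_ [h Gh <-] <-]].
      by exists (lact h k); [exists h | rewrite lractA].
    by exists h => //; rewrite lractA.
  by rewrite !aux => ->.
by rewrite -ggE; apply: sub.
Qed.

End DoubleQuotient.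
Arguments dquot {T} M G G1.
Arguments dquot_op {T M G G1} X Y.

Definition sub_morphism (A B : Type) (opA : A -> A -> set A)
    (opB : B -> B -> set B) (f : A -> B) : Prop :=
  forall a1 a2, f @` opA a1 a2 `<=` opB (f a1) (f a2).

Definition hyper_iso (A B : Type) (opA : A -> A -> set A)
    (opB : B -> B -> set B) : Prop :=
  exists f : A -> B, bijective f /\
    forall a1 a2, f @` opA a1 a2 = opB (f a1) (f a2).

(* N is a bimagma over f(T) via f. The subset f(T) of N is given as the monoid
   [FT] included in N by [incN], and [fT] is f restricted to T; the remaining
   fields are the formulas defining the operations of f(T) and its actions. *)
Record image_bimagma (T : monoidType) (M : bimagmaType T) (inc : T -> M)
    (FT : monoidType) (N : bimagmaType FT) (incN : FT -> N)
    (f : M -> N) (fT : T -> FT) : Prop := ImageBimagma {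
  incN_inj : injective incN;
  incN_fT : forall a, incN (fT a) = f (inc a);
  fT_surj : range fT = setT;
  fT_mul : forall a1 a2, fT a1 * fT a2 = fT (a1 * a2);
  f_lact : forall a b, lact (fT a) (f b) = f (lact a b);
  f_ract : forall b a, ract (f b) (fT a) = f (ract b a)
}.

(* Main.v *)
Require Import Defs.
From HB Require Import structures.
From mathcomp Require Import all_boot.
From mathcomp Require Import all_classical.
Import Algebra.

(** Everything rests on two descriptions of cosets as images.

    For (i), f carries the coset bG onto f(b)f(G), as a set.  So f(b)f(G)
    depends only on bG, which makes fbar well defined, and f maps the elements
    of bG into fbar(bG), which makes fbar a morphism for inclusion: a product
    x * y with x in b1G and y in b2G is sent to f(x) * f(y).  Since f is onto,
    so is fbar; the set of the b'G with f(b')f(G) = f(b)f(G) is then the fibre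
    of fbar over f(b)f(G), and the fibres of a surjection over distinct points
    are distinct, so that each point may be identified with its fibre.

    For (ii), the coset (bG)(G1/G) is the set of all cG with c in bG1
    ([dcoset_mcoset]).  Hence it depends only on bG1, and it determines bG1,
    which is the union of these cG because G is a submonoid of G1
    ([bigcup_dcoset]).  The map sending bG1 to (bG)(G1/G) is therefore a
    bijection.  Both hyperproducts consist of the classes of the products
    x * y with x in b1G1 and y in b2G1, so the bijection preserves them.

    As G is only a monoid, cosets need not be disjoint, and an element of bG
    need not generate bG.  All arguments thus compare cosets as sets, and
    representatives are never changed within a coset. *)

Set Implicit Arguments.
Unset Strict Implicit.

Local Open Scope classical_set_scope.
Local Open Scope group_scope.

(** * Classes of a hyperquotient *)

Lemma hclass_surj (A : Type) (cls : A -> set A) (X : hquot cls) :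
  exists b, hclass cls b = X.
Proof.
case: X => X Xcls; have [b _ eX] := set_mem Xcls.
by exists b; apply: val_inj.
Qed.

Lemma val_hclass (A : Type) (cls : A -> set A) (b : A) :
  val (hclass cls b) = cls b.
Proof. by []. Qed.

Lemma hclassP (A : Type) (cls : A -> set A) (b c : A) :
  hclass cls b = hclass cls c <-> cls b = cls c.
Proof.
by split=> [/(congr1 val)//|ebc]; apply: val_inj.
Qed.

(** The universal property of the hyperquotient, through which both maps of the
    theorem are defined. *)
Lemma hquot_lift (A C : Type) (cls : A -> set A) (h : A -> C) :
  (forall b c, cls b = cls c -> h b = h c) ->
  exists F : hquot cls -> C, forall b, F (hclass cls b) = h b.
Proof.
move=> h_cls; have [r rK] := choice (@hclass_surj A cls).
by exists (h \o r) => b; apply: h_cls; apply/hclassP; exact: rK.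
Qed.

Lemma bijective_inj_surj (A B : Type) (F : A -> B) :
  injective F -> (forall y, exists x, F x = y) -> bijective F.
Proof.
by move=> Finj /choice[F' F'K]; exists F' => // x; apply: Finj; rewrite F'K.
Qed.

Lemma mquot_opP (T : monoidType) (M : bimagmaType T) (G : set T)
    (X Y Z : mquot M G) :
  mquot_op X Y Z <-> exists x y, [/\ val X x, val Y y & mcoset G (x * y) = Z].
Proof.
split=> [[_ [x [y [Xx Yy ->]]] <-]|[x [y [Xx Yy <-]]]]; first by exists x, y.
by exists (x * y) => //; exists x, y.
Qed.

(** * The morphism induced by a surjection *)

Lemma lcoset_image (T FT : monoidType) (M : bisetType T) (N : bisetType FT)
    (f : M -> N) (fT : T -> FT) (G : set T) (b : M) :
  (forall b a, ract (f b) (fT a) = f (ract b a)) ->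
  lcoset (fT @` G) (f b) = f @` lcoset G b.
Proof.
by move=> fract; rewrite /lcoset !image_comp; apply: eq_imagel => g _ /=.
Qed.

Section InducedMorphism.
Context {T FT : monoidType} {M : bimagmaType T} {N : bimagmaType FT}.
Variables (G : set T) (f : {multiplicative M -> N}) (fT : T -> FT).
Hypothesis f_ract : forall b a, ract (f b) (fT a) = f (ract b a).

Lemma exists_induced_map : exists fbar : mquot M G -> mquot N (fT @` G),
  forall b, fbar (mcoset G b) = mcoset (fT @` G) (f b).
Proof.
apply: hquot_lift => b c ebc; apply/hclassP.
by rewrite !(lcoset_image _ _ f_ract) ebc.
Qed.

Lemma induced_sub_morphism (fbar : mquot M G -> mquot N (fT @` G)) :
  (forall b, fbar (mcoset G b) = mcoset (fT @` G) (f b)) ->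
  sub_morphism mquot_op mquot_op fbar.
Proof.
move=> fbarE X Y _ [_ /mquot_opP[x [y [Xx Yy <-]]] <-].
have val_fbar (Z : mquot M G) z : val Z z -> val (fbar Z) (f z).
  have [b <-] := hclass_surj Z; rewrite fbarE val_hclass => bz.
  by rewrite val_hclass (lcoset_image _ _ f_ract); exists z.
apply/mquot_opP; exists (f x), (f y); split; try exact: val_fbar.
by rewrite fbarE gmulfM.
Qed.

Lemma induced_surj (fbar : mquot M G -> mquot N (fT @` G)) :
  range f = setT ->
  (forall b, fbar (mcoset G b) = mcoset (fT @` G) (f b)) ->
  forall Z, exists X, fbar X = Z.
Proof.
move=> f_surj fbarE Z; have [n <-] := hclass_surj Z.
have [b _ <-] : range f n by rewrite f_surj.
by exists (mcoset G b).
Qed.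

End InducedMorphism.

(** This is what allows an element of N/f(G) to be identified with a set of
    elements of M/G. *)
Lemma fibre_inj (A B : Type) (F : A -> B) :
  (forall y, exists x, F x = y) -> injective (fun y => [set x | F x = y]).
Proof.
move=> F_surj y z eyz; have [x Fx] := F_surj y.
have /= <- : [set x | F x = z] x by rewrite -eyz.
by rewrite Fx.
Qed.

(** * Iterated quotients *)

Section IteratedQuotient.
Context {T : monoidType} {M : bimagmaType T}.
Variables G G1 : set T.
Hypotheses (G_submonoid : monoid_closed [in G]) (MG : normalizes M G).
Hypotheses (G1_submonoid : monoid_closed [in G1]) (sGG1 : G `<=` G1).

Lemma mem_lcoset_refl (H : set T) (b : M) :
  monoid_closed [in H] -> lcoset H b b.
Proof. by case=> /set_mem H1 _; exists 1 => //; rewrite ract1. Qed.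

(** Since gG acts on bG as g does on b, acting by all of G1/G amounts to letting
    c run over bG1.  This removes the action of G1/G from all that follows. *)
Lemma dcoset_mcoset (b : M) :
  dcoset G1 (mcoset G b) = [set mcoset G c | c in lcoset G1 b].
Proof.
rewrite eqEsubset; split.
  move=> W [_ [g G1g <-]]; rewrite qactE// => ->.
  by exists (ract b g) => //; exists g.
move=> _ [_ [g G1g <-] <-]; exists (gcoset G g); first by exists g.
by rewrite qactE.
Qed.

Lemma lcoset_trans (b c d : M) : lcoset G1 b c -> lcoset G c d -> lcoset G1 b d.
Proof.
move=> [g G1g <-] [h Gh <-]; exists (g * h); last by rewrite ractM.
have [_ G1M] := G1_submonoid.
by apply/set_mem/G1M; apply/mem_set => //; exact: sGG1.
Qed.

(** Each cG with c in bG1 lies in bG1 because G is contained in G1, and it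
    contains c because 1 is in G. *)
Lemma bigcup_dcoset (b : M) :
  \bigcup_(X in dcoset G1 (mcoset G b)) val X = lcoset G1 b.
Proof.
rewrite dcoset_mcoset bigcup_image eqEsubset; split=> [d [c]|c bc].
  exact: lcoset_trans.
by exists c => //; exact: mem_lcoset_refl.
Qed.

Lemma dcoset_eqP (b c : M) :
  dcoset G1 (mcoset G b) = dcoset G1 (mcoset G c) <-> lcoset G1 b = lcoset G1 c.
Proof.
split=> [ebc|ebc]; first by rewrite -!bigcup_dcoset ebc.
by rewrite !dcoset_mcoset ebc.
Qed.

Let dclass (b : M) : dquot M G G1 := hclass (dcoset G1) (mcoset G b).

(** A product of x in (bg)G by y in (b'g')G is already a product of x in bG1 by
    y in b'G1; conversely such x and y may serve as representatives of the
    cosets xG and yG, as 1 is in G. *)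
Lemma dquot_opP (b1 b2 : M) (Z : dquot M G G1) :
  dquot_op (dclass b1) (dclass b2) Z <->
  exists x y, [/\ lcoset G1 b1 x, lcoset G1 b2 y & dclass (x * y) = Z].
Proof.
rewrite /dclass; split=> [[W [X [Y [bX bY]]]]|[x [y [bx by_ <-]]]].
  move=> /mquot_opP[x [y [Xx Yy <-]]] <-; exists x, y; split=> //.
    by rewrite -bigcup_dcoset; exists X.
  by rewrite -bigcup_dcoset; exists Y.
exists (mcoset G (x * y)) => //; exists (mcoset G x), (mcoset G y); split.
- by rewrite val_hclass dcoset_mcoset; exists x.
- by rewrite val_hclass dcoset_mcoset; exists y.
- by apply/mquot_opP; exists x, y; split=> //; exact: mem_lcoset_refl.
Qed.

Lemma mquot_dquot_iso : hyper_iso (@mquot_op T M G1) (@dquot_op T M G G1).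
Proof.
have [F FE] : exists F : mquot M G1 -> dquot M G G1,
    forall b, F (mcoset G1 b) = dclass b.
  by apply: hquot_lift => b c /dcoset_eqP ebc; apply/hclassP.
exists F; split.
  apply: bijective_inj_surj => [X Y|Z].
    have [b <-] := hclass_surj X; have [c <-] := hclass_surj Y.
    by rewrite !FE => /hclassP/dcoset_eqP ebc; apply/hclassP.
  have [X <-] := hclass_surj Z; have [b <-] := hclass_surj X.
  by exists (mcoset G1 b).
move=> X Y; have [b1 <-] := hclass_surj X; have [b2 <-] := hclass_surj Y.
rewrite !FE eqEsubset; split=> [_ [_ /mquot_opP[x [y [bx by_ <-]]] <-]|Z].
  by apply/dquot_opP; exists x, y.
move=> /dquot_opP[x [y [bx by_ <-]]]; exists (mcoset G1 (x * y)) => //.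
by apply/mquot_opP; exists x, y.
Qed.

End IteratedQuotient.

Unset Implicit Arguments.

Theorem theorem5p4 (T : monoidType) (M : bimagmaType T) (G : set T)
    (G_submonoid : monoid_closed [in G]) (MG : normalizes M G) :
  (forall (inc : T -> M) (FT : monoidType) (N : bimagmaType FT)
      (incN : FT -> N) (f : {multiplicative M -> N}) (fT : T -> FT),
    weakly_admissible inc ->
    range f = setT ->
    image_bimagma inc incN f fT ->
    exists (fbar : mquot M G -> mquot N (fT @` G))
           (ident : mquot N (fT @` G) -> set (mquot M G)),
      [/\ forall b : M, fbar (mcoset G b) = mcoset (fT @` G) (f b),
          sub_morphism mquot_op mquot_op fbar,
          injective ident
        & forall b : M,
            ident (mcoset (fT @` G) (f b)) =
            [set mcoset G b' | b' in
              [set b' : M | mcoset (fT @` G) (f b)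
                            = mcoset (fT @` G) (f b')]]]) /\
  (forall G1 : set T,
    monoid_closed [in G1] -> normalizes M G1 -> G `<=` G1 ->
    hyper_iso (@mquot_op T M G1) (@dquot_op T M G G1)).
Proof.
split=> [inc FT N incN f fT _ f_surj [_ _ _ _ _ f_ract]|G1 G1_submonoid _ sGG1].
  have [fbar fbarE] := exists_induced_map G f_ract.
  exists fbar, (fun Z => [set X | fbar X = Z]); split=> //.
  - exact: (induced_sub_morphism f_ract).
  - by apply: fibre_inj; exact: (induced_surj f_surj).
  - move=> b; rewrite eqEsubset; split=> [X /=|_ [b' /= eb <-]].
      have [b' <-] := hclass_surj X => eX.
      by exists b' => //=; rewrite -eX fbarE.
    by rewrite fbarE eb.
exact: mquot_dquot_iso.
Qed.
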